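(* Let $n\ge 1$ and $m$ be integers with $m+2>3$, and let $\chi=(P_1,\ldots,P_{2n})$ be a vector field on $\mathbb{S}^{2n-1}$ of degree $m+2$ given by $$P_i=\Big(1-\sum_{k=1}^{2n}x_k^2\Big)f_i+\sum_{j=1}^{2n}A_{ij}x_j,\qquad i=1,\ldots,2n,$$ where $f_i\in\mathbb{R}[x_1,\ldots,x_{2n}]$ has degree $\le m$, $(A_{ij})$ is a skew-symmetric $2n\times 2n$ matrix of polynomials in $\mathbb{R}[x_1,\ldots,x_{2n}]$ of degree $\le m+1$, and $f_i=\sum_{k=1}^{2n}a_{ik}x_k^m+g_i$ for some $a_{ik}\in\mathbb{R}$ and $g_i\in\mathbb{R}[x_1,\ldots,x_{2n}]$. If $\chi$ is Hamiltonian, then $\deg g_i>m-1$ for some $i\in\{1,\ldots,2n\}$ or $\deg A_{ij}>m$ for some $i,j\in\{1,\ldots,2n\}$.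
   Context: $\mathbb{S}^{2n-1}=\{x\in\mathbb{R}^{2n} : \sum_i x_i^2=1\}$. A polynomial vector field $\chi=(P_1,\ldots,P_{2n})$ in $\mathbb{R}^{2n}$ is identified with the operator $\sum_i P_i\,\partial/\partial x_i$; its degree is $\max_i\deg P_i$. It is a vector field on $\mathbb{S}^{2n-1}$ if $\chi(\sum_i x_i^2-1)=K(\sum_i x_i^2-1)$ for some real polynomial $K$. A vector field $\chi=(P_1,\ldots,P_{2n})$ is called Hamiltonian if there is a smooth map $H:\mathbb{R}^{2n}\to\mathbb{R}$ such that $P_{2i-1}=-\frac{\partial H}{\partial x_{2i}}$ and $P_{2i}=\frac{\partial H}{\partial x_{2i-1}}$ for $1\le i\le n$. *)

(* Defs.v *)
From HB Require Import structures.
From mathcomp Require Import all_boot all_order all_algebra.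
From mathcomp Require Import all_classical all_reals all_analysis.
(* The notations of mpoly clash with those of MathComp-Analysis and the few
   that are needed are declared again below. *)
From mathcomp Require Import -(notations) mpoly.

Set Implicit Arguments.
Unset Strict Implicit.
Unset Printing Implicit Defensive.

Import Order.TTheory GRing.Theory Num.Theory.
Import numFieldNormedType.Exports.

Local Open Scope ring_scope.

Notation "{ 'mpoly' T [ n ] }" := (mpoly n T)
  (at level 0, T at level 2, n at level 200, format "{ 'mpoly'  T [ n ] }").
Notation "''X_' i" := (mpolyX _ (mnm1 i))
  (at level 8, i at level 2, format "''X_' i") : ring_scope.

(* msize is one more than the total degree (and 0 on the zero polynomial, which
   thus gets degree 0). *)
Definition tdeg (R : realType) (N : nat) (p : {mpoly R[N]}) : nat :=
  (mmeasure mdeg p).-1.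

Section VectorFields.
Variables (R : realType) (N : nat).

Definition vfield := 'I_N -> {mpoly R[N]}.

Implicit Types (P : vfield) (q : {mpoly R[N]}).

Definition vfield_deg P : nat := (\max_(i < N) tdeg (P i))%N.

Definition vfield_app P q : {mpoly R[N]} := \sum_(i < N) P i * mderiv i q.

Definition sqnorm_poly : {mpoly R[N]} := \sum_(k < N) 'X_k ^+ 2.

Definition vfield_on_sphere P : Prop :=
  exists K : {mpoly R[N]},
    vfield_app P (sqnorm_poly - 1) = K * (sqnorm_poly - 1).

Definition partial (i : 'I_N) (H : 'rV[R]_N -> R) (x : 'rV[R]_N) : R :=
  'D_(delta_mx 0 i) H x.

Fixpoint cont_diff (k : nat) (H : 'rV[R]_N -> R) : Prop :=
  if k is k'.+1 then
    continuous H /\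
    forall i : 'I_N, (forall x, derivable H x (delta_mx 0 i)) /\
                     cont_diff k' (partial i H)
  else continuous H.

Definition smooth (H : 'rV[R]_N -> R) : Prop := forall k, cont_diff k H.

Definition evalv (p : {mpoly R[N]}) (x : 'rV[R]_N) : R := meval (fun i => x 0 i) p.

End VectorFields.

Lemma coord_odd_subproof (n : nat) (i : 'I_n) : (2 * i < 2 * n)%N.
Proof. by rewrite ltn_pmul2l. Qed.

Lemma coord_even_subproof (n : nat) (i : 'I_n) : ((2 * i).+1 < 2 * n)%N.
Proof.
rewrite ltn_neqAle ltn_pmul2l // ltn_ord andbT.
by apply/eqP => /(congr1 odd); rewrite /= !oddM.
Qed.

(* Ordinals start at 0: for i : 'I_n these are the 1-based coordinates 2i-1 and
   2i of the pair of index i+1. *)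
Definition coord_odd (n : nat) (i : 'I_n) : 'I_(2 * n) :=
  Ordinal (coord_odd_subproof i).
Definition coord_even (n : nat) (i : 'I_n) : 'I_(2 * n) :=
  Ordinal (coord_even_subproof i).

Definition hamiltonian (R : realType) (n : nat) (P : vfield R (2 * n)) : Prop :=
  exists H : 'rV[R]_(2 * n) -> R,
    smooth H /\
    forall (i : 'I_n) (x : 'rV[R]_(2 * n)),
      evalv (P (coord_odd i)) x = - partial (coord_even i) H x /\
      evalv (P (coord_even i)) x = partial (coord_odd i) H x.

(* Main.v *)
Require Import Defs.
From HB Require Import structures.
From mathcomp Require Import all_boot all_order all_algebra.
From mathcomp Require Import all_classical all_reals all_analysis.
From mathcomp Require Import -(notations) mpoly.
From mathcomp Require Import zify ring.

(** Suppose, for contradiction, that every g_i has degree at most m - 1 and every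
    A_ij degree at most m. Then the homogeneous part of degree m + 2 of P_i is
    - r^2 * sum_k a_ik x_k^m, where r^2 is the squared norm; these forms are
    called [sphere_power_form] below.

    Up to the symplectic rotation that exchanges the two coordinates of each pair
    and changes one sign, a Hamiltonian field is the gradient of H. So the
    rotated polynomials q_l are the partial derivatives of a function, and the
    theorem reduces to two facts.

    - Equality of mixed derivatives: d_l q_k = d_k q_l as polynomials
      ([polynomial_gradient_closed]). An algebraic antiderivative replaces the
      second derivatives of H: let Q be a polynomial with d_l Q = q_l. Then H - Q
      is invariant under translations along e_l, hence so is its derivative along e_k, which is the
      polynomial q_k - d_k Q. Therefore 0 = d_l q_k - d_l d_k Q = d_l q_k - d_k q_l.

    - A closed family of forms r^2 * sum_k c_lk x_k^m vanishes when m > 1 and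
      there are at least two variables ([closed_sphere_power_forms_eq0]). For
      k <> l, compare in d_k q_l = d_l q_k the coefficients of x_k^(m+1), which
      gives (m + 2) c_lk = 0, and then those of x_k x_l^m, which gives
      2 c_ll = 0: the right-hand sides vanish because a monomial of r^2 x_j^m
      never contains a variable with exponent exactly one.

    Hence all a_ik are zero and every P_i has degree at most m + 1, contrary to
    the assumption on the degree of the field. *)

Set Implicit Arguments.
Unset Strict Implicit.
Unset Printing Implicit Defensive.

Import Order.TTheory GRing.Theory Num.Theory.
Import numFieldNormedType.Exports.
Local Open Scope ring_scope.
Local Open Scope classical_set_scope.

Local Notation "p @_ m" := (mcoeff m p)
  (at level 3, m at level 2, left associativity, format "p @_ m") : ring_scope.
Local Notation "''X_[' m ]" := (mpolyX _ m)
  (at level 8, m at level 99, format "''X_[' m ]") : ring_scope.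
Declare Scope multi_scope.
Delimit Scope multi_scope with MM.
Local Notation "0" := (@mnm0 _) : multi_scope.
Local Notation "'U_(' i )" := (mnm1 i)
  (at level 0, i at level 2, format "'U_(' i )") : multi_scope.
Local Infix "+" := mnm_add : multi_scope.
Local Infix "*+" := mnm_muln : multi_scope.

(** * Polynomial functions and their partial derivatives *)

Section PolynomialFunctions.
Variables (R : realType) (N : nat).
Implicit Types (p q : {mpoly R[N]}) (i k l : 'I_N) (x v : 'rV[R]_N).

Lemma evalvD p q x : evalv (p + q) x = evalv p x + evalv q x.
Proof. exact: mevalD. Qed.

Lemma evalvN p x : evalv (- p) x = - evalv p x.
Proof. exact: mevalN. Qed.

Lemma evalvM p q x : evalv (p * q) x = evalv p x * evalv q x.
Proof. exact: mevalM. Qed.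

Lemma is_derive_coord l x v :
  is_derive x v (fun y : 'rV[R]_N => y 0 l) (v 0 l).
Proof.
have lim_h :
    (fun h : R =>
       h^-1 *: (((fun y : 'rV[R]_N => y 0 l) \o shift x) (h *: v) - x 0 l))
      @ 0^' --> v 0 l.
  apply: cvg_near_cst; near=> h.
  rewrite /= !mxE addrK scalerA mulVf ?scale1r //.
  by near: h; exact: nbhs_dnbhs_neq.
by split; [apply/cvg_ex; exists (v 0 l) | exact: cvg_lim].
Unshelve. all: by end_near. Qed.

(** The polynomials with this property contain the constants and the variables and
    are closed under sums and products. *)
Lemma is_derive_evalv i p x :
  is_derive x (delta_mx 0 i) (evalv p) (evalv (mderiv i p) x).
Proof.
have evalvC c : evalv (mpolyC N c) = cst c by apply/funext => y; exact: mevalC.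
have derC c :
    is_derive x (delta_mx 0 i) (evalv (mpolyC N c)) (evalv (mderiv i (mpolyC N c)) x).
  by rewrite evalvC mderivC /evalv meval0; exact: is_derive_cst.
have derM p1 p2 :
    is_derive x (delta_mx 0 i) (evalv p1) (evalv (mderiv i p1) x) ->
    is_derive x (delta_mx 0 i) (evalv p2) (evalv (mderiv i p2) x) ->
    is_derive x (delta_mx 0 i) (evalv (p1 * p2)) (evalv (mderiv i (p1 * p2)) x).
  move=> d1 d2.
  have -> : evalv (p1 * p2) = evalv p1 * evalv p2.
    by apply/funext => y; exact: evalvM.
  apply: is_derive_eq (is_deriveM d1 d2) _.
  by rewrite mderivM evalvD !evalvM addrC ![_ *: _]mulrC [_ * evalv p1 x]mulrC.
have derX k :
    is_derive x (delta_mx 0 i) (evalv 'X_k) (evalv (mderiv i 'X_k) x).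
  have -> : evalv ('X_k : {mpoly R[N]}) = fun y : 'rV[R]_N => y 0 k.
    by apply/funext => y; exact: mevalXU.
  apply: is_derive_eq (is_derive_coord k x _) _.
  rewrite mderivX mxE mnm1E /evalv mevalZ eq_sym eqxx /=.
  case: eqVneq => [->|_]; last by rewrite mul0r.
  by rewrite -[X in mnm_sub X _]add0m addmK mpolyX0 meval1 mulr1.
elim/mpolyind: p => [|c m p _ _ IHp].
  by rewrite -(mpolyC0 N).
have -> : evalv (c *: 'X_[m] + p) = evalv (mpolyC N c * 'X_[m]) + evalv p.
  by apply/funext => y; rewrite mul_mpolyC; exact: evalvD.
rewrite mderivD -mul_mpolyC evalvD.
apply: is_deriveD => //; apply: (derM) => //.
rewrite mpolyXE_id; elim/big_ind: _ => // [|k _].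
  by rewrite -mpolyC1.
elim: (m k) => [|d IHd]; first by rewrite expr0 -mpolyC1.
by rewrite exprS; exact: derM.
Qed.

Lemma derive_evalv i p x :
  'D_(delta_mx 0 i) (evalv p) x = evalv (mderiv i p) x.
Proof. exact: (@derive_val _ _ _ _ _ _ _ (is_derive_evalv i p x)). Qed.

Lemma evalv0E p : evalv p 0 = p@_0%MM.
Proof.
elim/mpolyind: p => [|c m p _ _ IHp]; first by rewrite mcoeff0 /evalv meval0.
rewrite evalvD IHp mcoeffD mcoeffZ mcoeffX; congr (_ + _).
rewrite /evalv mevalZ mevalX; congr (_ * _).
have [->|/eqP m0] := eqVneq m 0%MM.
  by rewrite big1 // => i _; rewrite mnm0E expr0.
have /existsP[i mi] : [exists i, m i != 0%N].
  apply: contraT => /existsPn m0'; case: m0.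
  by apply/mnmP => i; rewrite mnm0E; apply/eqP; have := m0' i; rewrite negbK.
by rewrite (bigD1 i) //= mxE expr0n (negbTE mi) mul0r.
Qed.

(** All iterated derivatives of a zero function vanish, and at the origin they are
    the coefficients of p up to nonzero factorials. *)
Lemma evalv_eq0 p : (forall x, evalv p x = 0) -> p = 0.
Proof.
have deriv_eq0 i (r : {mpoly R[N]}) : evalv r = cst 0 -> evalv (mderiv i r) = cst 0.
  move=> r0; apply/funext => x.
  by rewrite -derive_evalv r0 derive_cst.
move=> /funext p0; apply/mpolyP => m; rewrite mcoeff0.
have : evalv (mderivm m p) = cst 0.
  rewrite /mderivm; elim: (enum _) => //= k s IHs.
  by elim: (m k) => //= d IHd; exact: deriv_eq0.
move/(congr1 (fun F => F 0)); rewrite evalv0E mcoeff_mderivm addm0 => /eqP.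
rewrite mulrn_eq0 => /orP[|/eqP //]; rewrite -leqn0 leqNgt prodn_gt0 // => i.
by rewrite ffact_gt0.
Qed.

Lemma mderiv_antiderivative l q : exists Q : {mpoly R[N]}, mderiv l Q = q.
Proof.
elim/mpolyind: q => [|c m p _ _ [Q <-]]; first by exists 0; rewrite mderiv0.
exists ((c / (m l).+1%:R) *: 'X_[(m + U_(l))%MM] + Q).
rewrite mderivD mderivZ mderivX addmK mnmDE mnm1E eqxx addn1 scalerA.
by rewrite divfK // pnatr_eq0.
Qed.

(** On each line of direction v the function G is a function of one real variable
    with zero derivative. *)
Lemma derive0_invariant (G : 'rV[R]_N -> R) v :
  (forall x, is_derive x v G 0) -> forall (t : R) x, G (t *: v + x) = G x.
Proof.
move=> dG t x.
have Gline s : is_derive s (1 : R) (fun r : R => G (r *: v + x)) 0.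
  have quotientE :
      (fun h : R => h^-1 *: (((fun r : R => G (r *: v + x)) \o shift s) (h *: 1)
                             - G (s *: v + x)))
      = (fun h : R => h^-1 *: ((G \o shift (s *: v + x)) (h *: v)
                               - G (s *: v + x))).
    by apply/funext => h /=; rewrite [h *: 1]mulr1 scalerDl addrA.
  have [dG1 dG2] := dG (s *: v + x).
  by split; rewrite /derivable /derive quotientE.
by have := @is_derive_0_is_cst _ _ t 0 Gline; rewrite scale0r add0r.
Qed.

Lemma derive_translate (G : 'rV[R]_N -> R) u v x :
  (forall y, G (u + y) = G y) -> 'D_v G (u + x) = 'D_v G x.
Proof.
move=> Ginv; rewrite /derive.
suff -> : (fun h : R => h^-1 *: ((G \o shift (u + x)) (h *: v) - G (u + x)))
        = (fun h : R => h^-1 *: ((G \o shift x) (h *: v) - G x)) by [].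
by apply/funext => h /=; rewrite addrCA !Ginv.
Qed.

(** Subtracting an antiderivative Q of q_l along e_l leaves a function G that does
    not depend on the l-th coordinate, and neither does its derivative along e_k. *)
Lemma polynomial_gradient_closed (H : 'rV[R]_N -> R) (q : 'I_N -> {mpoly R[N]}) :
  (forall i x, is_derive x (delta_mx 0 i) H (evalv (q i) x)) ->
  forall k l, mderiv l (q k) = mderiv k (q l).
Proof.
move=> dH k l; have [Q dQ] := mderiv_antiderivative l (q l).
pose G := H - evalv Q.
have dG i x : is_derive x (delta_mx 0 i) G (evalv (q i - mderiv i Q) x).
  by rewrite evalvD evalvN; apply: is_deriveB; exact: is_derive_evalv.
have Ginv : forall (t : R) x, G (t *: delta_mx 0 l + x) = G x.
  apply: derive0_invariant => x.
  by have := dG l x; rewrite dQ subrr /evalv meval0.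
have dkG x : evalv (q k - mderiv k Q) x = 'D_(delta_mx 0 k) G x.
  by have [_ ->] := dG k x.
transitivity (mderiv l (mderiv k Q)); last by rewrite mderiv_comm dQ.
apply/eqP; rewrite -subr_eq0 -mderivB; apply/eqP.
apply: evalv_eq0 => x.
rewrite -derive_evalv /derive.
rewrite (_ : (fun h => _) = cst 0) ?lim_cst //; apply/funext => h /=.
by rewrite !dkG derive_translate ?subrr ?scaler0 //; exact: Ginv.
Qed.

End PolynomialFunctions.

(** * Closed families of forms r^2 * sum_k c_k x_k^m *)

Section SphereForms.
Variables (R : realType) (N : nat).
Implicit Types (c : 'I_N -> R) (k l : 'I_N).

Definition sphere_power_form (m : nat) c : {mpoly R[N]} :=
  sqnorm_poly R N * \sum_k c k *: 'X_k ^+ m.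

Lemma mcoeff_sphere_power_form m c mu :
  (sphere_power_form m c)@_mu =
  \sum_k c k * \sum_i ((U_(i) *+ 2 + U_(k) *+ m)%MM == mu)%:R.
Proof.
rewrite /sphere_power_form mulr_sumr linear_sum; apply: eq_bigr => k _ /=.
rewrite -scalerAr mcoeffZ mulr_suml linear_sum; congr (_ * _).
by apply: eq_bigr => i _; rewrite /= !mpolyXn -mpolyXD mcoeffX.
Qed.

Lemma mcoeff_sphere_power_form_pure m c k : (0 < m)%N ->
  (sphere_power_form m c)@_(U_(k) *+ (m + 2))%MM = c k.
Proof.
move=> m_gt0; rewrite mcoeff_sphere_power_form.
have eq_mono i j :
    ((U_(i) *+ 2 + U_(j) *+ m)%MM == (U_(k) *+ (m + 2))%MM) = (i == k) && (j == k).
  apply/eqP/andP => [/mnmP/(_ k)|[/eqP-> /eqP->]].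
    rewrite mnmDE !mulmnE !mnm1E eqxx.
    by case: (i == k); case: (j == k) => //=; lia.
  by apply/mnmP => j'; rewrite mnmDE !mulmnE; lia.
rewrite (bigD1 k) //= (bigD1 k) //= eq_mono !eqxx big1 => [|i /negbTE ik].
  rewrite addr0 mulr1 big1 ?addr0 // => j /negbTE jk.
  by rewrite big1 ?mulr0 // => i _; rewrite eq_mono jk andbF.
by rewrite eq_mono ik.
Qed.

(** Every exponent in x_i^2 x_k^m is 0, 2, m or m + 2, hence never 1. *)
Lemma mcoeff_sphere_power_form_linear m c (mu : multinom N) l :
  (1 < m)%N -> mu l = 1%N -> (sphere_power_form m c)@_mu = 0.
Proof.
move=> m_gt1 mu_l; rewrite mcoeff_sphere_power_form.
apply: big1 => k _; rewrite big1 ?mulr0 // => i _.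
case: eqP => // /mnmP/(_ l); rewrite mnmDE !mulmnE !mnm1E mu_l.
by case: (i == l); case: (k == l) => /=; lia.
Qed.

(** For m = 2 the monomial x_k^2 x_l^m also occurs in r^2 x_k^m, which is why the
    other coefficients are assumed to vanish. *)
Lemma mcoeff_sphere_power_form_mixed m c k l :
  (forall j, j != l -> c j = 0) ->
  (sphere_power_form m c)@_(U_(k) *+ 2 + U_(l) *+ m)%MM = c l.
Proof.
move=> c0; rewrite mcoeff_sphere_power_form (bigD1 l) //= addrC.
rewrite big1 => [|j /c0 ->]; last by rewrite mul0r.
rewrite add0r (bigD1 k) //= eqxx big1 ?addr0 ?mulr1 // => i ik.
rewrite eqm_add2r; case: eqP => // /mnmP/(_ k).
by rewrite !mulmnE !mnm1E (negbTE ik) eqxx.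
Qed.

(** The off-diagonal coefficients must be treated first, since for m = 2 the
    equation for c_ll also involves c_lk. The family q only has to agree with the
    forms in degree m + 2, because differentiation respects degrees. *)
Lemma closed_sphere_power_forms_eq0 (m : nat) (c : 'I_N -> 'I_N -> R)
    (q : 'I_N -> {mpoly R[N]}) :
  (1 < m)%N -> (1 < N)%N ->
  (forall l (mu : multinom N), mdeg mu = (m + 2)%N ->
     (q l)@_mu = (sphere_power_form m (c l))@_mu) ->
  (forall k l, mderiv l (q k) = mderiv k (q l)) ->
  forall l k, c l k = 0.
Proof.
move=> m_gt1 N_gt1 q_top q_closed.
have mulrSn_inj0 n (x : R) : x *+ n.+1 = 0 -> x = 0.
  by move/eqP; rewrite mulrn_eq0 => /eqP.
(* Coefficient of x_k^(m+1) in d_k q_l = d_l q_k. *)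
have off_diag l k : k != l -> c l k = 0.
  move=> kl; have /(congr1 (mcoeff (U_(k) *+ (m + 1))%MM)) := q_closed l k.
  rewrite !mcoeff_mderiv.
  rewrite [in RHS]q_top ?mdegD ?mdegMn ?mdeg1; last by lia.
  rewrite [in RHS](@mcoeff_sphere_power_form_linear _ _ _ l) //; last first.
    by rewrite mnmDE mulmnE !mnm1E eqxx (negbTE kl).
  rewrite mul0rn => /mulrSn_inj0.
  have -> : (U_(k) *+ (m + 1) + U_(k))%MM = (U_(k) *+ (m + 2))%MM.
    by apply/mnmP => i; rewrite mnmDE !mulmnE; lia.
  rewrite q_top ?mcoeff_sphere_power_form_pure //; first by lia.
  by rewrite mdegMn mdeg1; lia.
move=> l k; have [->|] := eqVneq k l; last exact: off_diag.
(* Coefficient of x_k x_l^m, for any k different from l. *)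
have [{}k kl] : exists k : 'I_N, k != l.
  have [l0|l0] := eqVneq (val l) 0%N.
    by exists (Ordinal N_gt1); rewrite -val_eqE /= l0.
  by exists (Ordinal (ltnW N_gt1)); rewrite -val_eqE /= eq_sym.
have /(congr1 (mcoeff (U_(k) + U_(l) *+ m)%MM)) := q_closed l k.
rewrite !mcoeff_mderiv.
rewrite [in RHS]q_top ?mdegD ?mdegMn ?mdeg1; last by lia.
rewrite [in RHS](@mcoeff_sphere_power_form_linear _ _ _ k) //; last first.
  by rewrite !mnmDE mulmnE !mnm1E eqxx eq_sym (negbTE kl).
rewrite mul0rn => /mulrSn_inj0.
have -> : (U_(k) + U_(l) *+ m + U_(k))%MM = (U_(k) *+ 2 + U_(l) *+ m)%MM.
  by apply/mnmP => i; rewrite !mnmDE !mulmnE; lia.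
rewrite q_top ?mcoeff_sphere_power_form_mixed //; first exact: off_diag.
by rewrite mdegD !mdegMn !mdeg1; lia.
Qed.

End SphereForms.

(** * Total degree *)

Section TotalDegree.
Variables (R : realType) (N : nat).
Implicit Types (p q : {mpoly R[N]}) (k : 'I_N).

Lemma tdeg_leP p d : (tdeg p <= d)%N = (mmeasure mdeg p <= d.+1)%N.
Proof. by rewrite /tdeg; case: mmeasure. Qed.

Lemma tdegD_le p q d : (tdeg p <= d)%N -> (tdeg q <= d)%N -> (tdeg (p + q)%R <= d)%N.
Proof.
rewrite !tdeg_leP => pd qd; apply: leq_trans (mmeasureD_le _ _ _) _.
by rewrite geq_max pd.
Qed.

Lemma tdegN p : tdeg (- p) = tdeg p.
Proof. by rewrite /tdeg mmeasureN. Qed.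

Lemma tdegM_le p q d e :
  (tdeg p <= d)%N -> (tdeg q <= e)%N -> (tdeg (p * q)%R <= d + e)%N.
Proof.
have [->|p0] := eqVneq p 0; first by rewrite mul0r /tdeg mmeasure0.
have [->|q0] := eqVneq q 0; first by rewrite mulr0 /tdeg mmeasure0.
by rewrite /tdeg msizeM //; move: (mmeasure _ p) (mmeasure _ q) => a b; lia.
Qed.

Lemma tdeg_sum_le (I : finType) (F : I -> {mpoly R[N]}) d :
  (forall i, tdeg (F i) <= d)%N -> (tdeg (\sum_i F i)%R <= d)%N.
Proof.
move=> Fd; elim/big_ind: _ => // [|p q]; first by rewrite /tdeg mmeasure0.
exact: tdegD_le.
Qed.

Lemma tdegXn k d : tdeg ('X_k ^+ d : {mpoly R[N]}) = d.
Proof. by rewrite /tdeg mpolyXn mmeasureX /= mdegMn mdeg1 mul1n. Qed.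

Lemma mcoeff_gt_tdeg p (mu : multinom N) : (tdeg p < mdeg mu)%N -> p@_mu = 0.
Proof.
move=> p_mu; apply: memN_msupp_eq0; apply: mmeasure_mnm_ge.
exact: leq_trans (leqSpred _) p_mu.
Qed.

End TotalDegree.

(** * The symplectic rotation *)

Section SymplecticRotation.
Variable n : nat.

Lemma half_coord_subproof (l : 'I_(2 * n)) : (l./2 < n)%N.
Proof. by have := ltn_ord l; lia. Qed.

Definition half_coord (l : 'I_(2 * n)) : 'I_n := Ordinal (half_coord_subproof l).

Lemma coord_oddK : cancel (@coord_odd n) half_coord.
Proof. by move=> i; apply/val_inj => /=; lia. Qed.

Lemma coord_evenK : cancel (@coord_even n) half_coord.
Proof. by move=> i; apply/val_inj => /=; lia. Qed.

Lemma coordP (l : 'I_(2 * n)) :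
  l = if odd l then coord_even (half_coord l) else coord_odd (half_coord l).
Proof. by case: ifP => odd_l; apply/val_inj => /=; lia. Qed.

(** Turns a Hamiltonian field back into the gradient of its Hamiltonian. *)
Definition symplectic_rotation (V : zmodType) (v : 'I_(2 * n) -> V)
    (l : 'I_(2 * n)) : V :=
  if odd l then - v (coord_odd (half_coord l)) else v (coord_even (half_coord l)).

Lemma symplectic_rotation_odd (V : zmodType) (v : 'I_(2 * n) -> V) i :
  symplectic_rotation v (coord_odd i) = v (coord_even i).
Proof. by rewrite /symplectic_rotation coord_oddK /= mul2n odd_double. Qed.

Lemma symplectic_rotation_even (V : zmodType) (v : 'I_(2 * n) -> V) i :
  symplectic_rotation v (coord_even i) = - v (coord_odd i).
Proof. by rewrite /symplectic_rotation coord_evenK /= mul2n odd_double. Qed.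

Lemma coord_ind (S : 'I_(2 * n) -> Prop) :
  (forall i, S (coord_odd i)) -> (forall i, S (coord_even i)) -> forall l, S l.
Proof. by move=> So Se l; rewrite [l]coordP; case: ifP. Qed.

End SymplecticRotation.

Theorem theorem3p7 (R : realType) (n m : nat)
  (hn : (1 <= n)%N) (hm : (3 < m + 2)%N)
  (P : vfield R (2 * n))
  (f : 'I_(2 * n) -> {mpoly R[2 * n]})
  (A : 'M[{mpoly R[2 * n]}]_(2 * n))
  (a : 'M[R]_(2 * n))
  (g : 'I_(2 * n) -> {mpoly R[2 * n]})
  (P_sphere : vfield_on_sphere P)
  (P_deg : vfield_deg P = (m + 2)%N)
  (f_deg : forall i, (tdeg (f i) <= m)%N)
  (A_skew : A^T = - A)
  (A_deg : forall i j, (tdeg (A i j) <= m + 1)%N)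
  (P_def : forall i,
     P i = (1 - \sum_(k < 2 * n) 'X_k ^+ 2) * f i
           + \sum_(j < 2 * n) A i j * 'X_j)
  (f_def : forall i, f i = \sum_(k < 2 * n) a i k *: 'X_k ^+ m + g i)
  (P_ham : hamiltonian P) :
  (exists i, (m - 1 < tdeg (g i))%N) \/
  (exists i j, (m < tdeg (A i j))%N).
Proof.
apply: contrapT => /not_orP[g_small A_small].
have {g_small} g_deg i : (tdeg (g i) <= m - 1)%N.
  by rewrite leqNgt; apply/negP => gi; apply: g_small; exists i.
have {A_small} A_deg' i j : (tdeg (A i j) <= m)%N.
  by rewrite leqNgt; apply/negP => Aij; apply: A_small; exists i, j.
pose r2 : {mpoly R[2 * n]} := sqnorm_poly R (2 * n).
(* What remains of P_i without its part of degree m + 2. *)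
pose low i := P i + sphere_power_form m (a i).
have low_deg i : (tdeg (low i) <= m + 1)%N.
  have r2_deg : (tdeg r2 <= 2)%N by apply: tdeg_sum_le => k; rewrite tdegXn.
  have lowE : low i = f i - r2 * g i + \sum_(j < 2 * n) A i j * 'X_j.
    rewrite /low P_def f_def /sphere_power_form -/(sqnorm_poly R (2 * n)) -/r2.
    by ring.
  rewrite lowE; apply: tdegD_le; first apply: tdegD_le.
  - by apply: leq_trans (f_deg i) _; lia.
  - rewrite tdegN; apply: leq_trans (tdegM_le r2_deg (g_deg i)) _; lia.
  - apply: tdeg_sum_le => j; apply: tdegM_le => //.
    by rewrite -['X_j]expr1 tdegXn.
have P_top i (mu : multinom (2 * n)) : mdeg mu = (m + 2)%N ->
    (P i)@_mu = - (sphere_power_form m (a i))@_mu.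
  move=> mu_deg; have /eqP : (low i)@_mu = 0.
    by apply: mcoeff_gt_tdeg; rewrite mu_deg; apply: leq_ltn_trans (low_deg i) _; lia.
  by rewrite mcoeffD addr_eq0 => /eqP.
have [H [H_smooth H_P]] := P_ham.
have H_grad i x :
    is_derive x (delta_mx 0 i) H (evalv (symplectic_rotation P i) x).
  have [_ /(_ i)[dH _]] := H_smooth 1%N.
  split; first exact: dH.
  rewrite -/(partial i H x); elim/coord_ind: i {dH} => i; have [H1 H2] := H_P i x.
    by rewrite symplectic_rotation_odd H2.
  by rewrite symplectic_rotation_even evalvN H1 opprK.
have a0 i k : a i k = 0.
  have rot_a0 : forall l k, symplectic_rotation (fun i => - a i k) l = 0.
    apply: (@closed_sphere_power_forms_eq0 _ _ m _ (symplectic_rotation P)).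
    - lia.
    - lia.
    - move=> l mu mu_deg; elim/coord_ind: l => l.
        rewrite symplectic_rotation_odd P_top // !mcoeff_sphere_power_form -sumrN.
        by apply: eq_bigr => j _; rewrite symplectic_rotation_odd mulNr.
      rewrite symplectic_rotation_even mcoeffN P_top // opprK !mcoeff_sphere_power_form.
      by apply: eq_bigr => j _; rewrite symplectic_rotation_even opprK.
    - exact: polynomial_gradient_closed H_grad.
  elim/coord_ind: i => i; apply/eqP.
    by have := rot_a0 (coord_even i) k; rewrite symplectic_rotation_even opprK => ->.
  by rewrite -oppr_eq0; have := rot_a0 (coord_odd i) k; rewrite symplectic_rotation_odd => ->.
have P_low i : P i = low i.
  rewrite /low /sphere_power_form [\sum_k _]big1 ?mulr0 ?addr0 // => k _.
  by rewrite a0 scale0r.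
suff : (vfield_deg P <= m + 1)%N by rewrite P_deg; lia.
by apply/bigmax_leqP => i _; rewrite P_low.
Qed.
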